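(* Let $R$ be a countable domain, let $\boldsymbol A=(A^{(n)})_{n\in\omega}$ be a tower of countable $R$-modules, and let $\alpha<\omega_1$. Then $$s_\alpha\big({\lim}^1\boldsymbol A\big)={\lim}^1\boldsymbol A_\alpha,$$ where $\boldsymbol A_\alpha$ is the $\alpha$-th derived tower of $\boldsymbol A$ and ${\lim}^1\boldsymbol A_\alpha$ is regarded as a submodule of ${\lim}^1\boldsymbol A$ via the homomorphism induced by the inclusion $\boldsymbol A_\alpha\to\boldsymbol A$.
   Context: A tower of countable modules is a sequence $(A^{(n)})_{n\in\omega}$ of countable modules with homomorphisms $p^{(n,n+1)}:A^{(n+1)}\to A^{(n)}$; $p^{(n,m)}:A^{(m)}\to A^{(n)}$ ($n\le m$) denotes the composite bonding map. For each countable limit ordinal $\lambda$ fix a strictly increasing sequence $(\lambda_n)$ of successor ordinals with supremum $\lambda$; if $\alpha$ is zero or a successor put $\alpha_n=\alpha$ for all $n$. Derived towers. $A_0^{(n)}=A^{(n)}$; for each successor ordinal $\alpha$, $A^{(n)}_\alpha=\bigcap_{k\in\omega}p^{(n,n+k)}\big(A^{(n+k)}_{(\alpha-1)_k}\big)$. For every $\alpha<\omega_1$, $\boldsymbol A_\alpha$ is the tower $(A^{(n)}_{\alpha_n})_{n\in\omega}$. Modules with a Polish cover. A Polish module is an $R$-module that is a Polish abelian group on which each $r\in R$ acts continuously. A module with a Polish cover is $G=\hat G/N$ with $\hat G$ a Polish module and $N$ a Polishable submodule (image of a continuous injective homomorphism from a Polish module). A submodule with a Polish cover is $\hat H/N$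 with $N\subseteq\hat H\subseteq\hat G$ Polishable; its Borel complexity in $G$ is that of $\hat H$ in $\hat G$. $\lim^1\boldsymbol A$ is regarded as the module with a Polish cover $\hat G/N$, where $\hat G=\prod_nA^{(n)}$ (product of discrete modules) and $N$ is the image of $\prod_nA^{(n)}\to\prod_nA^{(n)}$, $(x_n)\mapsto(x_n-p^{(n,n+1)}(x_{n+1}))$. Solecki submodules. $s_0(G)$ is the closure of $\{0\}$ in $G$; $s_1(G)$ is the smallest $\boldsymbol\Pi^0_3$ submodule with a Polish cover of $G$ (it exists); $s_{\alpha+1}(G)=s_1(s_\alpha(G))$; $s_\lambda(G)=\bigcap_{\alpha<\lambda}s_\alpha(G)$ for $\lambda$ limit. *)

(* Defs.v *)
From HB Require Import structures.
From mathcomp Require Import all_boot all_order all_algebra.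
From mathcomp Require Import all_classical all_reals.
From mathcomp Require Import topology tvs borel_hierarchy.

Set Implicit Arguments.
Unset Strict Implicit.
Unset Printing Implicit Defensive.

Import Order.TTheory GRing.Theory Num.Theory.
Local Open Scope classical_set_scope.
Local Open Scope ring_scope.

Section Polish.
Context (K : realType).

Definition is_metric (T : Type) (d : T -> T -> K) : Prop :=
  [/\ forall x y, d x y = 0 <-> x = y,
      forall x y, d x y = d y x &
      forall x y z, d x z <= d x y + d y z].

Definition metrizes (T : topologicalType) (d : T -> T -> K) : Prop :=
  forall (x : T) (A : set T),
    nbhs x A <-> exists2 r, 0 < r & [set y | d x y < r] `<=` A.

Definition complete_metric (T : topologicalType) (d : T -> T -> K) : Prop :=
  forall u : nat -> T,
    (forall r, 0 < r -> exists N, forall m n,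
      (N <= m)%N -> (N <= n)%N -> d (u m) (u n) < r) ->
    exists l : T, u @ \oo --> l.

Definition polish (T : topologicalType) : Prop :=
  (exists2 D : set T, countable D & dense D) /\
  exists d : T -> T -> K, [/\ is_metric d, metrizes d & complete_metric d].

End Polish.

(* The scalar ring carries no topology and need not be a numDomainType, so the
   topologicalLmodType of the library does not apply. *)
Record polishModule (K : realType) (R : pzRingType) := PolishModule {
  pm_zmod : topologicalZmodType;
  pm_scale : R -> pm_zmod -> pm_zmod;
  pm_scaleA : forall a b x, pm_scale a (pm_scale b x) = pm_scale (a * b) x;
  pm_scale1 : left_id 1 pm_scale;
  pm_scaleDr : right_distributive pm_scale +%R;
  pm_scaleDl : forall x, {morph pm_scale^~ x : a b / a + b};
  pm_scale_continuous : forall a, continuous (pm_scale a);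
  pm_polish : polish K pm_zmod
}.

Definition pm_sort K R (M : polishModule K R) : Type := pm_zmod M.
Coercion pm_sort : polishModule >-> Sortclass.
HB.instance Definition _ K R (M : polishModule K R) :=
  TopologicalZmodule.on (pm_sort M).
HB.instance Definition _ K R (M : polishModule K R) :=
  GRing.Zmodule_isLmodule.Build R (pm_sort M) (@pm_scaleA K R M)
    (@pm_scale1 K R M) (@pm_scaleDr K R M) (@pm_scaleDl K R M).

(* A complete separated filtration by subgroups of countable index; it is used to
   show that products of countable modules, and the coboundaries, are Polish. *)
Record filtration (M : zmodType) := Filtration {
  fil :> nat -> M -> Prop;
  filB : forall n x y, fil n x -> fil n y -> fil n (x - y);
  filS : forall n x, fil n.+1 x -> fil n x;
  fil_sep : forall x, (forall n, fil n x) -> x = 0;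
  fil_count : forall n, exists D : set M,
    countable D /\ forall x, exists2 d, D d & fil n (x - d);
  fil_complete : forall u : nat -> M,
    (forall n, fil n (u n.+1 - u n)) -> exists l, forall n, fil n (l - u n)
}.

Section FiltrationTheory.
Context (M : zmodType) (V : filtration M).

Lemma fil0 n : V n 0.
Proof.
have [D [_ /(_ 0)[d _ h]]] := fil_count V n.
by rewrite -(subrr (0 - d)); exact: filB.
Qed.

Lemma filN n x : V n x -> V n (- x).
Proof. by move=> h; rewrite -sub0r; apply: filB => //; exact: fil0. Qed.

Lemma filC n x y : V n (x - y) -> V n (y - x).
Proof. by move=> /filN; rewrite opprB. Qed.

Lemma fil_trans n x y z : V n (x - y) -> V n (y - z) -> V n (x - z).
Proof.
by move=> hx /filN hy; have := filB hx hy; rewrite opprK addrA addrNK.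
Qed.

Lemma fil_le m n x : (m <= n)%N -> V n x -> V m x.
Proof.
elim: n => [|n IH]; first by rewrite leqn0 => /eqP->.
by rewrite leq_eqVlt => /predU1P[->//|/IH h] /filS /h.
Qed.

End FiltrationTheory.

(* The group topology with basic neighborhoods the cosets of a filtration. *)
Definition fil_nbhs (M : zmodType) (V : filtration M) (x : M) : set_system M :=
  [set A | exists n, [set y | V n (y - x)] `<=` A].

Section FiltrationPolish.
Context (K : realType) (M : topologicalZmodType) (V : filtration M).
Hypothesis Vnbhs : forall (x : M) (A : set M), nbhs x A <-> fil_nbhs V x A.

Let Vex (x : M) : x != 0 -> exists n, `[< ~ V n x >].
Proof.
move=> /eqP x0; apply: contrapT => h; apply: x0; apply: (@fil_sep _ V) => n.
by apply: contrapT => hn; apply: h; exists n; apply/asboolP.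
Qed.

Let dist (x y : M) : K :=
  match pselect (x - y != 0) with
  | left h => (ex_minn (Vex h)).+1%:R^-1
  | right _ => 0
  end.

Let distP x y n : dist x y < n.+1%:R^-1 <-> V n (x - y).
Proof.
rewrite /dist; case: pselect => [h|/negP]; last first.
  by rewrite negbK => /eqP ->; split => _; [exact: fil0|rewrite invr_gt0 ltr0n].
case: ex_minnP => m /asboolP hm mmin.
rewrite ltf_pV2 ?posrE ?ltr0n// ltr_nat ltnS.
split=> [nm|Vn].
  apply: contrapT => hn; have := mmin n.
  by rewrite asboolT// leqNgt nm => /(_ isT).
by rewrite ltnNge; apply/negP => mn; apply: hm; exact: fil_le Vn.
Qed.

Let distE x y : dist x y = 0 \/ exists n, dist x y = n.+1%:R^-1.
Proof.
by rewrite /dist; case: pselect => h; [right; eexists; reflexivity|left].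
Qed.

Let dist_ge0 x y : 0 <= dist x y.
Proof. by case: (distE x y) => [->//|[n ->]]; rewrite invr_ge0 ler0n. Qed.

Let small (r : K) : 0 < r -> exists n, n.+1%:R^-1 < r.
Proof.
move=> r0; exists (Num.trunc r^-1).
rewrite -[ltRHS]invrK ltf_pV2 ?posrE ?ltr0n ?invr_gt0//.
exact: Num.Theory.truncnS_gt.
Qed.

Let dist_le x y (r : K) : 0 <= r ->
  (forall n, r < n.+1%:R^-1 -> V n (x - y)) -> dist x y <= r.
Proof.
move=> r0 h; case: (distE x y) => [->//|[n dn]].
rewrite leNgt; apply/negP; rewrite dn => /h/distP.
by rewrite dn ltxx.
Qed.

Let distC x y : dist x y = dist y x.
Proof. by apply/le_anti/andP; split; apply: dist_le => // n /distP/filC. Qed.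

Lemma filtration_polish : polish K M.
Proof.
split.
  have [D hD] := choice (fil_count V).
  exists (\bigcup_n D n); first by apply: bigcup_countable => // n _; case: (hD n).
  move=> O [x Ox] oO; have : nbhs x O by apply: open_nbhs_nbhs.
  move=> /Vnbhs[n nO]; have [_ /(_ x)[d Dd Vd]] := hD n.
  by exists d; split; [apply: nO => /=; exact: filC|exists n].
exists dist; split.
- split=> [x y|x y|x y z].
  + split=> [d0|->].
      apply/eqP; rewrite -subr_eq0; apply/eqP; apply: (@fil_sep _ V) => n; apply/distP.
      by rewrite d0 invr_gt0 ltr0n.
    by rewrite /dist; case: pselect => // h; case/eqP: (h); exact: subrr.
  + exact: distC.
  + apply: dist_le => [|n h]; first exact: addr_ge0.
    apply: (@fil_trans _ V _ _ y); apply/distP; apply: le_lt_trans h.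
      by rewrite lerDl.
    by rewrite lerDr.
- move=> x A; split=> [/Vnbhs[n nA]|[r /small[n nr] rA]].
    exists n.+1%:R^-1; first by rewrite invr_gt0 ltr0n.
    by move=> y /distP/filC; exact: nA.
  apply/Vnbhs; exists n => y /filC/distP h; apply: rA; exact: lt_trans nr.
- move=> u uC.
  have /choice[N hN] : forall k : nat, exists N, forall m n,
      (N <= m)%N -> (N <= n)%N -> V k (u m - u n).
    move=> k; have [|N hN] := uC k.+1%:R^-1; first by rewrite invr_gt0 ltr0n.
    by exists N => m n hm hn; apply/distP; exact: hN.
  pose s n := (\sum_(i < n.+1) N i)%N.
  have sN n : (N n <= s n)%N by rewrite /s big_ord_recr leq_addl.
  have sS n : (s n <= s n.+1)%N by rewrite /s [leqRHS]big_ord_recr leq_addr.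
  have [n|l hl] := @fil_complete _ V (u \o s).
    by apply: hN => //=; exact: leq_trans (sS n).
  exists l => A /Vnbhs[n nA]; exists (s n) => // m /= snm; apply: nA => /=.
  apply: (@fil_trans _ V _ _ (u (s n))); last exact: filC.
  by apply: hN => //; exact: leq_trans snm.
Qed.

End FiltrationPolish.

Definition fil_type (M : zmodType) (V : filtration M) : Type := M.

Section FiltrationTopology.
Context (M : zmodType) (V : filtration M).

Lemma fil_nbhs_filter (x : M) : ProperFilter (fil_nbhs V x).
Proof.
split; first by case=> n /(_ x); apply => /=; rewrite subrr; exact: fil0.
split; first by exists 0%N.
- move=> A B [m mA] [n nB]; exists (maxn m n) => y /= h; split.
    by apply: mA; apply: fil_le h; exact: leq_maxl.
  by apply: nB; apply: fil_le h; exact: leq_maxr.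
- by move=> A B AB [n nA]; exists n; exact: subset_trans AB.
Qed.

Lemma fil_nbhs_singleton (x : M) (A : set M) : fil_nbhs V x A -> A x.
Proof. by case=> n; apply => /=; rewrite subrr; exact: fil0. Qed.

Lemma fil_nbhs_nbhs (x : M) (A : set M) :
  fil_nbhs V x A -> fil_nbhs V x (fil_nbhs V ^~ A).
Proof.
case=> n nA; exists n => y /= yx; exists n => z /= zy; apply: nA.
exact: fil_trans zy yx.
Qed.

Lemma fil_nbhs_sub (x y : M) (A : set M) : fil_nbhs V (x - y) A ->
  exists n, forall x' y', V n (x' - x) -> V n (y' - y) -> A (x' - y').
Proof.
case=> n nA; exists n => x' y' hx hy; apply: nA => /=.
suff -> : x' - y' - (x - y) = x' - x - (y' - y) by exact: filB.
by rewrite !opprB [y - x]addrC addrACA [- y' + y]addrC.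
Qed.

HB.instance Definition _ := GRing.Zmodule.on (fil_type V).
HB.instance Definition _ := hasNbhs.Build (fil_type V) (fil_nbhs V).
HB.instance Definition _ := Nbhs_isNbhsTopological.Build (fil_type V)
  fil_nbhs_filter fil_nbhs_singleton fil_nbhs_nbhs.

Lemma fil_sub_continuous : continuous (fun x : fil_type V * fil_type V => x.1 - x.2).
Proof.
move=> -[x y] A /fil_nbhs_sub[n nA].
exists ([set x' | V n (x' - x)], [set y' | V n (y' - y)]).
  by split; exists n.
by move=> -[x' y'] [/= hx hy]; exact: nA.
Qed.

HB.instance Definition _ :=
  PreTopologicalNmodule_isTopologicalZmodule.Build (fil_type V) fil_sub_continuous.

End FiltrationTopology.

Section FiltrationPolishModule.
Context (K : realType) (R : pzRingType) (M : lmodType R) (V : filtration M).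
Hypothesis VZ : forall n (a : R) x, V n x -> V n (a *: x).

Definition fil_scale (a : R) (x : fil_type V) : fil_type V := a *: (x : M).

Lemma fil_scale_continuous a : continuous (fil_scale a).
Proof.
move=> x A [n nA]; exists n => y /= yx; apply: nA => /=.
by rewrite /fil_scale -scalerBr; exact: VZ.
Qed.

Definition filtration_polishModule : polishModule K R :=
  @PolishModule K R (fil_type V) fil_scale (@scalerA R M) (@scale1r R M)
    (@scalerDr R M) (@scalerDl R M) fil_scale_continuous
    (@filtration_polish K (fil_type V) V (fun x A => iff_refl _)).

End FiltrationPolishModule.

Record submodule (R : pzRingType) (V : lmodType R) := Submodule {
  submodule_set :> V -> Prop;
  submodule0 : submodule_set 0;
  submoduleP : forall a x y,
    submodule_set x -> submodule_set y -> submodule_set (a *: x + y)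
}.

(* A submodule as a module in its own right. *)
Section SubmoduleType.
Context (R : pzRingType) (V : lmodType R) (P : submodule V).

Definition submodule_pred : pred V := fun x => `[< P x >].

Lemma submodule_pred_closed : submod_closed submodule_pred.
Proof.
split=> [|a x y /asboolP Px /asboolP Py]; apply/asboolP.
  exact: submodule0.
exact: submoduleP.
Qed.

HB.instance Definition _ :=
  GRing.isSubmodClosed.Build R V submodule_pred submodule_pred_closed.

Record submodule_type : Type := SubmoduleType {
  submodule_val : V;
  submodule_valP : submodule_val \in submodule_pred
}.

HB.instance Definition _ := [isSub for submodule_val].
HB.instance Definition _ := [Choice of submodule_type by <:].
HB.instance Definition _ := [SubChoice_isSubLmodule of submodule_type by <:].

End SubmoduleType.

Record tower (R : pzRingType) := Tower {
  tower_mod :> nat -> lmodType R;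
  bond : forall n, {linear tower_mod n.+1 -> tower_mod n};
  tower_countable : forall n, countable [set: tower_mod n]
}.

Section TowerProd.
Context (R : pzRingType) (A : tower R).

Definition tower_prod : Type := prod_topology (fun n => discrete_topology (A n)).

HB.instance Definition _ := Topological.copy tower_prod
  (prod_topology (fun n => discrete_topology (A n))).

Definition tower_prod_add (x y : tower_prod) : tower_prod := fun n => (x n : A n) + (y n : A n).
Definition tower_prod_opp (x : tower_prod) : tower_prod := fun n => - (x n : A n).
Definition tower_prod_zero : tower_prod := fun n => (0 : A n).

Lemma tower_prod_addA : associative tower_prod_add.
Proof. by move=> x y z; apply: functional_extensionality_dep => n; exact: addrA. Qed.
Lemma tower_prod_addC : commutative tower_prod_add.
Proof. by move=> x y; apply: functional_extensionality_dep => n; exact: addrC. Qed.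
Lemma tower_prod_add0 : left_id tower_prod_zero tower_prod_add.
Proof. by move=> x; apply: functional_extensionality_dep => n; exact: add0r. Qed.
Lemma tower_prod_addN : left_inverse tower_prod_zero tower_prod_opp tower_prod_add.
Proof. by move=> x; apply: functional_extensionality_dep => n; exact: addNr. Qed.

HB.instance Definition _ := GRing.isZmodule.Build tower_prod tower_prod_addA tower_prod_addC tower_prod_add0 tower_prod_addN.

Definition tower_prod_fil (n : nat) (x : tower_prod) : Prop :=
  forall i, (i < n)%N -> x i = 0 :> A i.

Lemma tower_prod_nbhsP (x : tower_prod) (B : set tower_prod) :
  nbhs x B <-> exists n, [set y | tower_prod_fil n (y - x)] `<=` B.
Proof.
split.
  pose F := filter_from [set: nat] (fun n => [set y | tower_prod_fil n (y - x)]).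
  have FF : Filter F.
    apply: filter_from_filter; first by exists 0%N.
    move=> i j _ _; exists (maxn i j) => // y /= h; split=> k hk; apply: h.
      by rewrite leq_max hk.
    by rewrite leq_max hk orbT.
  suff : F --> x by move=> /(_ B)/[apply] -[n _ nB]; exists n.
  apply/cvg_sup => i C; rewrite nbhsE => -[O [[O' _ <-] Ox] OC].
  exists i.+1 => // y /(_ i (ltnSn _)) hy; apply: OC => /=.
  suff -> : y i = x i by [].
  by apply/eqP; rewrite -subr_eq0; apply/eqP.
case=> n nB; apply: filterS nB _; elim: n => [|n IH].
  exact: filterS filterT.
have hn : nbhs x [set y : tower_prod | y n = x n :> A n].
  exact: (@proj_continuous _ (fun n => discrete_topology (A n)) n x _
    (discrete_set1 _)).
apply: filterS (filterI IH hn) => y [/= h yn] i; rewrite ltnS leq_eqVlt.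
case/predU1P => [->|]; last exact: h.
by apply/eqP; rewrite subr_eq0; apply/eqP.
Qed.

Lemma tower_prod_filB n x y :
  tower_prod_fil n x -> tower_prod_fil n y -> tower_prod_fil n (x - y).
Proof.
move=> hx hy i hi; have -> : (x - y) i = (x i : A i) - (y i : A i) by [].
by rewrite hx// hy// subrr.
Qed.

Lemma tower_prod_filS n x : tower_prod_fil n.+1 x -> tower_prod_fil n x.
Proof. by move=> h i hi; apply: h; exact: ltnW. Qed.

Lemma tower_prod_fil_sep x : (forall n, tower_prod_fil n x) -> x = 0.
Proof.
move=> h; apply: functional_extensionality_dep => n.
exact: (h n.+1 n (ltnSn n)).
Qed.

Lemma tower_prod_fil_count n : exists D : set tower_prod,
  countable D /\ forall x, exists2 d, D d & tower_prod_fil n (x - d).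
Proof.
elim: n => [|n [D [cD hD]]].
  by exists [set 0]; split=> // x; exists 0.
exists ((fun p : tower_prod * A n => dfwith p.1 n p.2 : tower_prod) @`
  (D `*` setT)).
split.
  apply: (sub_countable (card_image_le _ _)); apply: countableX => //.
  exact: tower_countable.
move=> x; have [d Dd hd] := hD x.
exists (dfwith d n (x n)); first by exists (d, x n).
move=> i; have -> : (x - (dfwith d n (x n) : tower_prod)) i =
  (x i : A i) - (dfwith d n (x n) i : A i) by [].
rewrite ltnS leq_eqVlt => /predU1P[->|ilt].
  by rewrite dfwithin subrr.
by rewrite dfwithout ?gt_eqF//; exact: hd.
Qed.

Lemma tower_prod_fil_complete (u : nat -> tower_prod) :
  (forall n, tower_prod_fil n (u n.+1 - u n)) ->
  exists l, forall n, tower_prod_fil n (l - u n).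
Proof.
move=> h; pose l : tower_prod := fun i => u i.+1 i.
exists l => n i; elim: n => // n IH.
have e m : (l - u m) i =
  (u i.+1 i : A i) - (u m i : A i) by [].
rewrite ltnS leq_eqVlt => /predU1P[<-|ilt]; first by rewrite e subrr.
have := h n i ilt; have -> : (u n.+1 - u n) i =
  (u n.+1 i : A i) - (u n i : A i) by [].
move=> /eqP; rewrite subr_eq0 => /eqP un.
by rewrite e un -e; exact: IH.
Qed.

Definition tower_prod_filtration : filtration tower_prod :=
  Filtration tower_prod_filB tower_prod_filS tower_prod_fil_sep tower_prod_fil_count tower_prod_fil_complete.

Lemma tower_prod_sub_continuous : continuous (fun x : tower_prod * tower_prod => x.1 - x.2).
Proof.
move=> -[x y] B /tower_prod_nbhsP/(@fil_nbhs_sub _ tower_prod_filtration)[n nB].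
exists ([set x' | tower_prod_fil n (x' - x)], [set y' | tower_prod_fil n (y' - y)]).
  by split; apply/tower_prod_nbhsP; exists n.
by move=> -[x' y'] [/= hx hy]; exact: nB.
Qed.

HB.instance Definition _ :=
  PreTopologicalNmodule_isTopologicalZmodule.Build tower_prod tower_prod_sub_continuous.

Definition tower_prod_scale (a : R) (x : tower_prod) : tower_prod := fun n => a *: (x n : A n).

Lemma tower_prod_scaleA a b x : tower_prod_scale a (tower_prod_scale b x) = tower_prod_scale (a * b) x.
Proof. by apply: functional_extensionality_dep => n; exact: scalerA. Qed.
Lemma tower_prod_scale1 : left_id 1 tower_prod_scale.
Proof. by move=> x; apply: functional_extensionality_dep => n; exact: scale1r. Qed.
Lemma tower_prod_scaleDr : right_distributive tower_prod_scale +%R.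
Proof. by move=> a x y; apply: functional_extensionality_dep => n; exact: scalerDr. Qed.
Lemma tower_prod_scaleDl x : {morph tower_prod_scale^~ x : a b / a + b}.
Proof. by move=> a b; apply: functional_extensionality_dep => n; exact: scalerDl. Qed.

Lemma tower_prod_scale_continuous a : continuous (tower_prod_scale a).
Proof.
move=> x B /tower_prod_nbhsP[n nB]; apply/tower_prod_nbhsP; exists n.
move=> y hy; apply: nB => i hi.
have -> : (tower_prod_scale a y - tower_prod_scale a x) i = a *: ((y - x) i : A i).
  by rewrite scalerBr.
by rewrite hy// scaler0.
Qed.

Definition tower_polish (K : realType) : polishModule K R :=
  @PolishModule K R tower_prod tower_prod_scale tower_prod_scaleA tower_prod_scale1 tower_prod_scaleDr tower_prod_scaleDl
    tower_prod_scale_continuous (@filtration_polish K _ tower_prod_filtration tower_prod_nbhsP).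

End TowerProd.

Section PolishCover.
Context (K : realType) (R : pzRingType).

Definition polishable (G : polishModule K R) (H : set G) : Prop :=
  exists (M : polishModule K R) (f : {linear M -> G}),
    [/\ continuous f, injective f & range f = H].

(* The module with a Polish cover (cover G) / (ker G). A submodule of it is
   represented by its preimage in the cover, a submodule containing ker G. *)
Record polishCover := PolishCover {
  cover :> polishModule K R;
  ker : set cover;
  ker_polishable : polishable ker
}.
Arguments ker : clear implicits.

Record coverHom (G H : polishCover) := CoverHom {
  lift :> {linear G -> H};
  lift_continuous : continuous lift;
  lift_ker : lift @` ker G `<=` ker H
}.

(* Injectivity, and the image, of the map induced by f on the quotients. *)
Definition cover_injective (G H : polishCover) (f : coverHom G H) : Prop :=
  f @^-1` ker H `<=` ker G.

Definition cover_image (G H : polishCover) (f : coverHom G H) : set H :=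
  [set y | exists x, ker H (y - f x)].

(* Countable intersections of F_sigma sets. *)
Definition Pi03 (T : topologicalType) (S : set T) : Prop :=
  exists2 F : nat -> set T, (forall i, Fsigma (F i)) & S = \bigcap_i F i.

Definition Pi03_submodule (G : polishCover) (S : set G) : Prop :=
  [/\ ker G `<=` S, polishable S & Pi03 S].

(* S is s_1(G). *)
Definition is_solecki1 (G : polishCover) (S : set G) : Prop :=
  Pi03_submodule S /\ forall S' : set G, Pi03_submodule S' -> S `<=` S'.

End PolishCover.
Arguments ker {K R} _.

Section Lim1.
Context (K : realType) (R : pzRingType) (A : tower R).

Local Notation P := (tower_polish A K).

Definition lim1_diff (x : P) : P :=
  fun n => (x n : A n) - bond A n (x n.+1).

Lemma lim1_diff_linear : linear lim1_diff.
Proof.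
move=> a x y; apply: functional_extensionality_dep => n.
have -> : (a *: lim1_diff x + lim1_diff y) n =
  a *: ((x n : A n) - bond A n (x n.+1)) + ((y n : A n) - bond A n (y n.+1)).
  by [].
have -> : lim1_diff (a *: x + y) n = (a *: (x n : A n) + (y n : A n)) -
  bond A n (a *: (x n.+1 : A n.+1) + (y n.+1 : A n.+1)) by [].
by rewrite linearP scalerBr addrACA opprD.
Qed.

HB.instance Definition _ := GRing.isLinear.Build R P P _ lim1_diff
  lim1_diff_linear.

Definition lim1_ker : set P := range lim1_diff.

Lemma lim1_ker_linear a x y :
  lim1_ker x -> lim1_ker y -> lim1_ker (a *: x + y).
Proof. by move=> [x' _ <-] [y' _ <-]; exists (a *: x' + y'); rewrite ?linearP. Qed.

Lemma lim1_ker0 : lim1_ker 0.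
Proof. by exists 0; rewrite ?linear0. Qed.

Definition lim1_kerSubmodule : submodule P :=
  Submodule lim1_ker0 lim1_ker_linear.

Local Notation B := (submodule_type lim1_kerSubmodule).

Local Notation fil_P := (tower_prod_filtration A : filtration P).

Lemma to_lim1_ker_subproof x : lim1_diff x \in
  submodule_pred lim1_kerSubmodule.
Proof. by apply/asboolP; exists x. Qed.

Definition to_lim1_ker (x : P) : B := SubmoduleType (to_lim1_ker_subproof x).

Lemma lim1_kerP (y : B) : exists x, val y = lim1_diff x.
Proof. by case: y => y /= /asboolP[x _ <-]; exists x. Qed.

Definition lim1_ker_fil n (y : B) : Prop :=
  exists2 x : P, fil_P n x & val y = lim1_diff x.

Lemma lim1_ker_filB n x y : lim1_ker_fil n x -> lim1_ker_fil n y -> lim1_ker_fil n (x - y).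
Proof.
move=> [x' hx ex] [y' hy ey]; exists (x' - y'); first exact: filB.
by rewrite raddfB /= ex ey -raddfB.
Qed.

Lemma lim1_ker_filS n x : lim1_ker_fil n.+1 x -> lim1_ker_fil n x.
Proof. by move=> [x' hx ex]; exists x' => //; exact: filS. Qed.

Lemma lim1_ker_filZ n (a : R) x : lim1_ker_fil n x -> lim1_ker_fil n (a *: x).
Proof.
move=> [x' hx ex]; exists (a *: x').
  move=> i hi; have -> : (a *: x') i = a *: (x' i : A i) by [].
  by rewrite (hx i hi) scaler0.
by rewrite !linearZ /= ex.
Qed.

Lemma lim1_diff_fil n x : fil_P n.+1 x -> fil_P n (lim1_diff x).
Proof.
move=> h i hi.
have -> : lim1_diff x i = (x i : A i) - bond A i (x i.+1) by [].
by rewrite (h i (ltnW hi)) (h i.+1 hi) linear0 subrr.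
Qed.

Lemma lim1_ker_fil_val n y : lim1_ker_fil n.+1 y -> fil_P n (val y).
Proof. by move=> [x hx ->]; exact: lim1_diff_fil. Qed.

Lemma lim1_ker_fil_sep x : (forall n, lim1_ker_fil n x) -> x = 0.
Proof.
move=> h; apply: val_inj; rewrite linear0; apply: (@fil_sep _ fil_P) => n.
exact: lim1_ker_fil_val.
Qed.

Lemma lim1_ker_fil_count n : exists D : set B,
  countable D /\ forall x, exists2 d, D d & lim1_ker_fil n (x - d).
Proof.
have [D [cD hD]] := fil_count fil_P n.
exists (to_lim1_ker @` D); split; first exact: (sub_countable (card_image_le _ _)).
move=> y; have [x yx] := lim1_kerP y; have [d Dd hd] := hD x.
exists (to_lim1_ker d); first by exists d.
by exists (x - d) => //; rewrite !raddfB /= yx.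
Qed.

Lemma lim1_ker_fil_complete (u : nat -> B) : (forall n, lim1_ker_fil n (u n.+1 - u n)) ->
  exists l, forall n, lim1_ker_fil n (l - u n).
Proof.
move=> h; have [w uw] := lim1_kerP (u 0%N).
have /choice[v hv] n : exists x, fil_P n x /\ val (u n.+1 - u n) = lim1_diff x.
  by have [x] := h n; exists x.
pose s n := w + \sum_(i < n) v i.
have sS n : s n.+1 = s n + v n by rewrite /s big_ord_recr /= addrA.
have us n : val (u n) = lim1_diff (s n).
  elim: n => [|n IH]; first by rewrite /s big_ord0 addr0.
  rewrite sS raddfD /= -IH -(hv n).2 raddfB /=.
  by rewrite addrC subrK.
have [n|l hl] := @fil_complete _ fil_P s.
  by rewrite sS addrC addKr; exact: (hv n).1.
exists (to_lim1_ker l) => n; exists ((l : P) - s n); first exact: hl.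
by rewrite raddfB /= us -raddfB.
Qed.

Definition lim1_ker_filtration : filtration B :=
  Filtration lim1_ker_filB lim1_ker_filS lim1_ker_fil_sep lim1_ker_fil_count lim1_ker_fil_complete.

Lemma lim1_ker_polishable : polishable lim1_ker.
Proof.
pose M := filtration_polishModule K (V := lim1_ker_filtration) lim1_ker_filZ.
pose f (x : M) : P := val (x : B).
have fl : linear f by move=> a x y; exact: linearP.
pose fL : {linear M -> P} := HB.pack f (GRing.isLinear.Build R M P _ f fl).
exists M, fL; split.
- move=> x C /tower_prod_nbhsP[n nC]; exists n.+1 => y /= /lim1_ker_fil_val h.
  by apply: nC; move: h; rewrite raddfB.
- by move=> x y /= h; apply: val_inj.
- apply/seteqP; split => y.
    by move=> [x _ <-]; have [z hz] := lim1_kerP x; exists z => //; rewrite -hz.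
  by move=> [x _ <-]; exists (to_lim1_ker x).
Qed.

Definition lim1 : polishCover K R := PolishCover lim1_ker_polishable.

End Lim1.

Record towerHom (R : pzRingType) (A B : tower R) := TowerHom {
  thom :> forall n, {linear A n -> B n};
  thomP : forall n x, thom n (bond A n x) = bond B n (thom n.+1 x)
}.

Section Lim1Map.
Context (K : realType) (R : pzRingType) (A B : tower R) (f : towerHom A B).

Definition lim1_map_fun (x : lim1 K A) : lim1 K B := fun n => f n (x n).

Lemma lim1_map_linear : linear lim1_map_fun.
Proof.
move=> a x y; apply: functional_extensionality_dep => n.
exact: (linearP (f n)).
Qed.

HB.instance Definition _ := GRing.isLinear.Build R (lim1 K A) (lim1 K B) _
  lim1_map_fun lim1_map_linear.

Lemma lim1_map_continuous : continuous lim1_map_fun.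
Proof.
move=> x C /tower_prod_nbhsP[n nC]; apply/tower_prod_nbhsP; exists n => y h.
apply: nC => i hi.
have -> : (lim1_map_fun y - lim1_map_fun x) i =
  f i (y i : A i) - f i (x i : A i) by [].
rewrite -raddfB; have := h i hi.
have -> : (y - x) i = (y i : A i) - (x i : A i) by [].
by move=> ->; rewrite raddf0.
Qed.

Lemma lim1_map_ker : lim1_map_fun @` ker (lim1 K A) `<=` ker (lim1 K B).
Proof.
move=> _ [_ [x _ <-] <-]; exists (lim1_map_fun x) => //.
apply: functional_extensionality_dep => n.
have -> : lim1_map_fun (lim1_diff x) n =
  f n ((x n : A n) - bond A n (x n.+1)) by [].
have -> : lim1_diff (lim1_map_fun x) n =
  f n (x n : A n) - bond B n (f n.+1 (x n.+1 : A n.+1)) by [].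
by rewrite -(thomP f) -raddfB.
Qed.

Definition lim1_map : coverHom (lim1 K A) (lim1 K B) :=
  CoverHom lim1_map_continuous lim1_map_ker.

End Lim1Map.

Section Ordinals.
Context {d : Order.disp_t} (W : orderType d).
Implicit Types a b c l : W.
Local Open Scope order_scope.

(* W is (isomorphic to) the first uncountable ordinal. *)
Record is_omega1 : Prop := IsOmega1 {
  omega1_wf : well_founded (fun a b => a < b);
  omega1_countable : forall a, countable [set b | b < a];
  omega1_uncountable : ~ countable [set: W]
}.

Definition is_zero a : Prop := forall b, a <= b.
Definition is_succ_of b a : Prop := b < a /\ forall c, c < a -> c <= b.
Definition is_succ a : Prop := exists b, is_succ_of b a.
Definition is_limit a : Prop := ~ is_zero a /\ ~ is_succ a.

Definition is_sup (S : set W) a : Prop :=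
  (forall b, S b -> b <= a) /\ forall c, (forall b, S b -> b <= c) -> a <= c.

(* The choice, for each a, of a sequence (a_n). *)
Record fundamentalSystem := FundamentalSystem {
  fund :> W -> nat -> W;
  fund_const : forall a n, ~ is_limit a -> fund a n = a;
  fund_succ : forall l n, is_limit l -> is_succ (fund l n);
  fund_incr : forall l n, is_limit l -> fund l n < fund l n.+1;
  fund_sup : forall l, is_limit l -> is_sup (range (fund l)) l
}.

Lemma fund_le (e : fundamentalSystem) a n : e a n <= a.
Proof.
have [la|na] := pselect (is_limit a); last by rewrite fund_const.
by apply: (fund_sup e la).1; exists n.
Qed.

Lemma fund_nonlimit (e : fundamentalSystem) a n : ~ is_limit (e a n).
Proof.
have [la|na] := pselect (is_limit a); last by rewrite fund_const.
by move=> [_]; apply; exact: fund_succ.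
Qed.

Lemma fund_leS (e : fundamentalSystem) a n : e a n <= e a n.+1.
Proof.
have [la|na] := pselect (is_limit a); last by rewrite !fund_const.
exact: ltW (fund_incr e _ la).
Qed.

Lemma fund_cofinal (e : fundamentalSystem) a b :
  ~ is_limit b -> b <= a -> exists n, b <= e a n.
Proof.
move=> nb ba; have [la|na] := pselect (is_limit a); last first.
  by exists 0%N; rewrite fund_const.
have {}ba : b < a by rewrite lt_neqAle ba andbT; apply/eqP => ab; rewrite ab in nb.
apply: contrapT => h; have := (fund_sup e la).2 b.
rewrite leNgt ba /= => H; suff: false by []. apply: H => _ [n _ <-].
by case: (leP (e a n) b) => // /ltW ben; case: h; exists n.
Qed.

Lemma is_succ_of_inj a b b' : is_succ_of b a -> is_succ_of b' a -> b = b'.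
Proof.
move=> [ba hb] [b'a hb']; apply/le_anti/andP; split; first exact: hb'.
exact: hb.
Qed.

Lemma nonlimitP a : ~ is_limit a -> is_zero a \/ is_succ a.
Proof.
move=> na; have [|nz] := pselect (is_zero a); first by left.
by right; apply: contrapT => ns; apply: na.
Qed.

End Ordinals.

Section Bonds.
Context (R : pzRingType) (A : tower R).

(* The bonding map from level n + k to level n; the level is written k + n so
   that the recursion is well typed. *)
Fixpoint bonds (k n : nat) : A (k + n) -> A n :=
  match k return A (k + n) -> A n with
  | 0 => id
  | k'.+1 => fun x => bonds (bond A (k' + n) x)
  end.

Lemma bonds_linear k n : linear (@bonds k n).
Proof. by elim: k => [//|k IH] a x y /=; rewrite linearP IH. Qed.

HB.instance Definition _ k n := GRing.isLinear.Build R (A (k + n)) (A n) _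
  (@bonds k n) (@bonds_linear k n).

(* Both sides say that x is the image of a point of P in level n + k + 1. *)
Lemma bonds_shift (P : forall m, A m -> Prop) k n (x : A n) :
  (exists2 y : A (k + n.+1), P _ y & bond A n (bonds y) = x) <->
  (exists2 y : A (k + n).+1, P _ y & bonds (bond A _ y) = x).
Proof.
elim: k P x => [//|k IH] P x.
pose P' m (z : A m) := exists2 y : A m.+1, P _ y & bond A m y = z.
split.
  move=> [y Py yx]; have [|z [y' Py' <-] zx] := (IH P' x).1.
    by exists (bond A _ y) => //; exists y.
  by exists y'.
move=> [y Py yx]; have [|z [y' Py' zE] zx] := (IH P' x).2.
  by exists (bond A _ y) => //; exists y.
by exists y' => //=; rewrite zE.
Qed.

End Bonds.

Section Derived.
Context {d : Order.disp_t} (W : orderType d) (e : fundamentalSystem W).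
Context (R : pzRingType) (A : tower R).
Implicit Types a b : W.

(* A^(n)_a, for a zero or successor; there is no clause for a limit. *)
Inductive derived : W -> forall n, A n -> Prop :=
| derived_zero a n (x : A n) : is_zero a -> derived a x
| derived_succ a b n (x : A n) : is_succ_of b a ->
    (forall k, exists2 y : A (k + n), derived (e b k) y & bonds y = x) ->
    derived a x.

Lemma derived_succP a b n (x : A n) : is_succ_of b a ->
  derived a x <->
  forall k, exists2 y : A (k + n), derived (e b k) y & bonds y = x.
Proof.
move=> ba; split; last exact: derived_succ.
move=> dx; case: dx ba => {a n x} [a n x za [ba _]|a b' n x b'a h ba].
  by have := za b; rewrite leNgt ba.
by rewrite (is_succ_of_inj ba b'a).
Qed.

Hypothesis hW : is_omega1 W.

Lemma fund_pred_lt a b k : is_succ_of b a -> (e b k < a)%O.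
Proof. by move=> [ba _]; exact: le_lt_trans (fund_le e b k) ba. Qed.

Lemma derived_submodule a : ~ is_limit a -> forall n,
  derived a (0 : A n) /\ forall (r : R) (x y : A n),
    derived a x -> derived a y -> derived a (r *: x + y).
Proof.
elim/(well_founded_ind (omega1_wf hW)): a => a IH.
case/nonlimitP => [za n|[b ba] n].
  by split=> *; exact: derived_zero.
have H k := IH (e b k) (fund_pred_lt k ba) (@fund_nonlimit _ _ e b k) (k + n)%N.
split=> [|r x y /(derived_succP _ ba) hx /(derived_succP _ ba) hy];
    apply/(derived_succP _ ba) => k.
  by exists 0; rewrite ?linear0//; exact: (H k).1.
have [x' dx <-] := hx k; have [y' dy <-] := hy k.
by exists (r *: x' + y'); rewrite ?linearP//; exact: (H k).2.
Qed.

Lemma derived_bond a n (x : A n.+1) : derived a x -> derived a (bond A n x).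
Proof.
elim/(well_founded_ind (omega1_wf hW)): a n x => a IH n x dx.
have [za|nza] := pselect (is_zero a); first exact: derived_zero.
have [b ba] : is_succ a by case: dx nza {IH} => // {}a b *; exists b.
apply/(derived_succP _ ba) => k.
have /bonds_shift[y dy <-] : exists2 z : A (k + n.+1),
    derived (e b k) z & bond A n (bonds z) = bond A n x.
  by have [z dz <-] := (derived_succP x ba).1 dx k; exists z.
by exists (bond A (k + n) y) => //; apply: IH => //; exact: fund_pred_lt.
Qed.

Lemma derived_bonds a k n (x : A (k + n)) : derived a x -> derived a (bonds x).
Proof. by elim: k x => [//|k IH] x dx /=; apply: IH; exact: derived_bond. Qed.

Lemma derived_le a b n (x : A n) :
  ~ is_limit b -> (b <= a)%O -> derived a x -> derived b x.
Proof.
elim/(well_founded_ind (omega1_wf hW)): a b n x => a IH b n x nb ba dx.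
have [zb|nzb] := pselect (is_zero b); first exact: derived_zero.
have [<-//|nab] := eqVneq a b.
have {}ba : (b < a)%O by rewrite lt_neqAle ba eq_sym nab.
have [c ca] : is_succ a.
  case: dx ba {IH nab} => [{}a {}n {}x za|{}a c *]; last by exists c.
  by rewrite ltNge za.
have [k bk] := fund_cofinal e nb (ca.2 _ ba).
have [y dy <-] := (derived_succP x ca).1 dx k.
by apply: derived_bonds; apply: IH dy => //; exact: fund_pred_lt.
Qed.

Variable a : W.

Definition derived_sub n : submodule (A n) :=
  Submodule (derived_submodule (@fund_nonlimit _ _ e a n) n).1
    (derived_submodule (@fund_nonlimit _ _ e a n) n).2.

Lemma derived_tower_bond_subproof n (x : submodule_type (derived_sub n.+1)) :
  bond A n (val x) \in submodule_pred (derived_sub n).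
Proof.
case: x => x /= /asboolP dx; apply/asboolP; apply: derived_bond.
apply: derived_le dx; [exact: fund_nonlimit|exact: fund_leS].
Qed.

Definition derived_tower_bond n (x : submodule_type (derived_sub n.+1)) :
  submodule_type (derived_sub n) := SubmoduleType (derived_tower_bond_subproof x).

Lemma derived_tower_bond_linear n : linear (@derived_tower_bond n).
Proof.
move=> r x y; apply: val_inj.
by rewrite [RHS]linearP /= linearP.
Qed.

HB.instance Definition _ n := GRing.isLinear.Build R _ _ _
  (@derived_tower_bond n) (@derived_tower_bond_linear n).

Lemma derived_tower_countable n : countable [set: submodule_type (derived_sub n)].
Proof.
have /countable_injP[f /in2TT finj] := @tower_countable R A n.
apply/countable_injP; exists (f \o val) => x y _ _ /= /finj; exact: val_inj.
Qed.

(* The tower with A^(n)_(a_n) in level n. *)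
Definition derived_tower : tower R :=
  @Tower R (fun n => submodule_type (derived_sub n)) (@derived_tower_bond)
    derived_tower_countable.

Lemma derived_incl_subproof n (x : derived_tower n.+1) :
  val (bond derived_tower n x) = bond A n (val x).
Proof. by []. Qed.

Definition derived_incl : towerHom derived_tower A :=
  @TowerHom R derived_tower A (fun n => \val) derived_incl_subproof.

End Derived.

Section Solecki.
Context {d : Order.disp_t} (W : orderType d) (K : realType) (R : pzRingType).

(* solecki a S : s_a(G) is the submodule S / ker G of G. In the successor clause
   s_b(G) = H / ker G is made into a module with a Polish cover, G', by means of
   a continuous injection f with range H; the topology this gives H does not
   depend on G' and f, so there is at most one S for each a. In the clause for
   zero, closure (ker G) is the preimage of the closure of 0 in the quotient. *)
Inductive solecki (G : polishCover K R) : W -> set G -> Prop :=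
| solecki_zero a : is_zero a -> solecki a (closure (ker G))
| solecki_succ a b (H : set G) (G' : polishCover K R) (f : {linear G' -> G}) S :
    is_succ_of b a -> solecki b H ->
    continuous f -> injective f -> range f = H -> f @^-1` ker G = ker G' ->
    is_solecki1 S -> solecki a (f @` S)
| solecki_limit a (S : W -> set G) : is_limit a ->
    (forall b, (b < a)%O -> solecki b (S b)) ->
    solecki a (\bigcap_(b in [set b | (b < a)%O]) S b).

End Solecki.

(* Main.v *)
(* Write N for the range of D = [lim1_diff] on the product of the A^(n), and call
   E(C) = (prod C^(n)) + N for a family C of submodules. Then E(C) is Polish for
   the filtration by V_n(C) = {x + D w : x in prod C, x and w vanish below n}, and
   N = E(0). With B = A_b and B1 = A_(b+1), the intersection of the images of the
   B^(n+k), the successor step s_1(E(B)/N) = E(B1)/N rests on one fact: V_n(B1) is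
   contained in the closure of V_n(0) in E(B).
   - E(B1) is the intersection over n of the unions of the countably many sets
     closure(D d + V_n(0)), by a diagonal argument, so it is Pi^0_3.
   - If S contains N and is an intersection of unions of closed sets C_ij, Baire
     category in N puts a coset of some V_n(0), hence a coset of V_n(B1), into
     some C_ij; these cosets are dense, so S meets E(B1) in a comeager subgroup,
     which is everything.
   Both the injectivity of the comparison map and the diagonal arguments (here and
   at limits) use that the inverse limit of A / A_a vanishes. *)

Require Import Defs.
From HB Require Import structures.
From mathcomp Require Import all_boot all_order all_algebra.
From mathcomp Require Import all_classical all_reals.
From mathcomp Require Import topology tvs borel_hierarchy.

Set Implicit Arguments.
Unset Strict Implicit.
Unset Printing Implicit Defensive.

Import Order.TTheory GRing.Theory Num.Theory.
Local Open Scope classical_set_scope.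
Local Open Scope ring_scope.


(** * Closure properties of submodules *)

Section SubmoduleClosure.
Context (R : pzRingType) (V : lmodType R) (C : submodule V).

Lemma submoduleD x y : C x -> C y -> C (x + y).
Proof. by move=> Cx Cy; rewrite -[x]scale1r; exact: submoduleP. Qed.

Lemma submoduleZ a x : C x -> C (a *: x).
Proof.
by move=> Cx; rewrite -[_ *: _]addr0; apply: submoduleP => //; exact: submodule0.
Qed.

Lemma submoduleN x : C x -> C (- x).
Proof. by rewrite -scaleN1r; exact: submoduleZ. Qed.

Lemma submoduleB x y : C x -> C y -> C (x - y).
Proof. by move=> Cx Cy; apply: submoduleD => //; exact: submoduleN. Qed.

End SubmoduleClosure.

(** * Baire category for complete filtered groups *)

Section Baire.
Context (M : zmodType) (V : filtration M).

Lemma filtration_baire (U : nat -> set M) :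
  (forall i b n, exists a m, V n (a - b) /\ [set y | V m (y - a)] `<=` U i) ->
  forall b n, exists2 x, V n (x - b) & forall i, U i x.
Proof.
move=> hU b n.
have /choice[f hf] (p : nat * (M * nat)) : exists q : M * nat,
    [/\ V p.2.2 (q.1 - p.2.1), (p.2.2 < q.2)%N &
        [set y | V q.2 (y - q.1)] `<=` U p.1].
  have [a [m [am mU]]] := hU p.1 p.2.1 p.2.2.
  (* Forcing the index to grow strictly makes the [i]-th index at least [i], as the completeness of
     the filtration requires. *)
  exists (a, maxn m p.2.2.+1); split=> //=; first exact: leq_maxr.
  by move=> y /= h; apply: mU; apply: fil_le h; exact: leq_maxl.
pose s := fix s i := if i is j.+1 then f (j, s j) else (b, n).
have s_le i : (n <= (s i).2)%N /\ (i <= (s i).2)%N.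
  elim: i => [|i [ni ii]]; first by split.
  have [_ lt_s _] := hf (i, s i).
  by split; [apply: leq_trans ni (ltnW lt_s)|apply: leq_ltn_trans ii lt_s].
have sV i j : (i <= j)%N -> V (s i).2 ((s j).1 - (s i).1).
  elim: j => [|j IH]; first by rewrite leqn0 => /eqP->; rewrite subrr;
    exact: fil0.
  rewrite leq_eqVlt => /predU1P[->|]; first by rewrite subrr; exact: fil0.
  rewrite ltnS => ij; have [h _ _] := hf (j, s j).
  apply: fil_trans (IH ij); apply: fil_le h => /=.
  elim: {IH} j ij => [|j IH]; first by rewrite leqn0 => /eqP->.
  rewrite leq_eqVlt => /predU1P[->//|/IH h]; apply: leq_trans h _.
  by have [_ /ltnW] := hf (j, s j).
have [i|l hl] := @fil_complete _ V (fun i => (s i).1).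
  by have [h _ _] := hf (i, s i); apply: fil_le h; exact: (s_le i).2.
have lV i : V (s i).2 (l - (s i).1).
  have le_i := (s_le i).2.
  by apply: fil_trans (hl (s i).2) _; exact: sV.
exists l => [|i]; first exact: (lV 0%N).
by have [_ _] := hf (i, s i); apply; exact: (lV i.+1).
Qed.

(* Apply the Baire property to the complements. *)
Lemma filtration_baire_cover (C : nat -> set M) :
  (forall j x, (forall m, exists2 y, V m (y - x) & C j y) -> C j x) ->
  forall b n, (forall x, V n (x - b) -> exists j, C j x) ->
  exists j a m, V n (a - b) /\ [set y | V m (y - a)] `<=` C j.
Proof.
move=> Ccl b n bC; apply: contrapT => hno.
(* Outside the coset of [b] the condition is void, so density of [U j] only has to be checked inside
   the coset. *)
pose U j := [set x | V n (x - b) -> ~ C j x].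
have [|x bx Ux] := filtration_baire (U := U) _ b n; last first.
  by have [j Cx] := bC _ bx; exact: Ux Cx.
move=> j a m; have [am|nam] := pselect (V n (a - b)); last first.
  exists a, (maxn m n); split; first by rewrite subrr; exact: fil0.
  move=> y /= /(fil_le (leq_maxr _ _)) /filC ay yb; case: nam.
  exact: fil_trans ay yb.
have [y ya nCy] : exists2 y, V (maxn m n) (y - a) & ~ C j y.
  apply: contrapT => h; apply: hno; exists j, a, (maxn m n); split=> // y /= ya.
  by apply: contrapT => nC; apply: h; exists y.
have [k hk] : exists k, forall z, V k (z - y) -> ~ C j z.
  apply: contrapT => h; apply: nCy; apply: Ccl => k.
  apply: contrapT => h'; apply: h; exists k => z zy Cz.
  by apply: h'; exists z.
exists y, k; split; first by apply: fil_le ya; exact: leq_maxl.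
by move=> z /= zy _; exact: hk.
Qed.

(* The subgroup meets each of its translates, being comeager. *)
Lemma filtration_comeager_subgroup (S : set M) (U : nat -> set M) :
  (forall x y, S x -> S y -> S (x - y)) ->
  (forall i b n, exists a m, V n (a - b) /\ [set y | V m (y - a)] `<=` U i) ->
  \bigcap_i U i `<=` S -> forall x, S x.
Proof.
move=> SB hU US x.
(* The [U i] sit at even indices and their translates by [x] at odd ones. A common point [y] has
   both [y] and [y - x] in [S], and [x] is their difference. *)
pose U' i := if odd i then [set y | U i./2 (y - x)] else U i./2.
have [|y _ yU] := filtration_baire (U := U') _ 0 0%N.
  move=> i b n; rewrite /U'; case: ifP => _; last exact: hU.
  have [a [m [ab am]]] := hU i./2 (b - x) n.
  exists (a + x), m; split; first by rewrite -addrA; move: ab; rewrite opprB.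
  by move=> y /= h; apply: am => /=; rewrite -addrA -opprD [x + a]addrC.
have Sy : S y by apply: US => i _; have := yU i.*2;
  rewrite /U' odd_double doubleK.
have Syx : S (y - x).
  apply: US => i _; have := yU i.*2.+1.
  by rewrite /U' /= odd_double uphalf_double.
by have := SB _ _ Sy Syx; rewrite opprB addrC subrK.
Qed.

End Baire.


(** * Rearrangements of sums in an abelian group *)

Section Rearrangement.
Context (V : zmodType).
Implicit Types a b c d : V.

Lemma subrDBB a b c d : a - (b + c) - (d - b) = a - d - c.
Proof. by rewrite !opprD opprK !addrA [LHS](ACl (1*4*3*(2*5)))/= addNr addr0. Qed.

Lemma addrBDB a b c d : a + b - c = a - d + (b - (c - d)).
Proof. by rewrite opprB !addrA [RHS](ACl (1*3*5*(2*4)))/= addNr addr0. Qed.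

Lemma subrBB a b c d : a - b - (c - d) = a - c - (b - d).
Proof. by rewrite !opprB [d - c]addrC [d - b]addrC addrACA. Qed.

Lemma subr_subl a b c : a - c = b - c - (b - a).
Proof. by rewrite opprB [RHS]addrC addrA subrK. Qed.

End Rearrangement.

(** * The Polish module E(C) *)

Section SubProduct.
Context (K : realType) (R : pzRingType) (A : tower R).

Local Notation P := (tower_polish A K).
Local Notation D := (@lim1_diff K R A).
Local Notation fil_P := (tower_prod_filtration A : filtration P).

Definition subProd (C : forall n, submodule (A n)) (x : P) : Prop :=
  forall n, C n (x n).

Lemma tower_subE (x y : P) i : (x - y) i = (x i : A i) - (y i : A i).
Proof. by []. Qed.

Lemma tower_addE (x y : P) i : (x + y) i = (x i : A i) + (y i : A i).
Proof. by []. Qed.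

Lemma lim1_diffE (x : P) i : D x i = (x i : A i) - bond A i (x i.+1).
Proof. by []. Qed.

Lemma lim1_diffD (x y : P) : D (x + y) = D x + D y.
Proof. exact: raddfD. Qed.

Lemma lim1_diffB (x y : P) : D (x - y) = D x - D y.
Proof. exact: raddfB. Qed.

Lemma lim1_diffZ a (x : P) : D (a *: x) = a *: D x.
Proof. exact: linearZ. Qed.

Lemma lim1_diff0 : D 0 = 0.
Proof. exact: raddf0. Qed.

Section Fixed.
Variable C : forall n, submodule (A n).

Lemma subProd0 : subProd C 0.
Proof. by move=> n; exact: submodule0. Qed.

Lemma subProdD x y : subProd C x -> subProd C y -> subProd C (x + y).
Proof. by move=> hx hy n; rewrite tower_addE; exact: submoduleD. Qed.

Lemma subProdB x y : subProd C x -> subProd C y -> subProd C (x - y).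
Proof. by move=> hx hy n; rewrite tower_subE; exact: submoduleB. Qed.

Lemma subProdZ a x : subProd C x -> subProd C (a *: x).
Proof.
move=> hx n; have -> : (a *: x) n = a *: (x n : A n) by [].
exact: submoduleZ.
Qed.

Lemma tower_filD n x y : fil_P n x -> fil_P n y -> fil_P n (x + y).
Proof.
move=> hx hy; rewrite -[y]opprK.
by apply: (@filB _ fil_P) => //; exact: (@filN _ fil_P).
Qed.

Lemma tower_filZ n a x : fil_P n x -> fil_P n (a *: x).
Proof.
move=> hx i hi; have -> : (a *: x) i = a *: (x i : A i) by [].
by rewrite (hx i hi) scaler0.
Qed.

(* For n = 0 the conditions on the filtration are void, and this is the preimage
   in the cover of the image of lim^1 C. *)
Definition cobdry n (y : P) : Prop :=
  exists w : P, [/\ fil_P n w, fil_P n (y - D w) & subProd C (y - D w)].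

Lemma cobdryD n x y : cobdry n x -> cobdry n y -> cobdry n (x + y).
Proof.
move=> [w [w1 w2 w3]] [v [v1 v2 v3]]; exists (w + v).
rewrite lim1_diffD opprD addrACA; split; [exact: tower_filD|exact: tower_filD|].
exact: subProdD.
Qed.

Lemma cobdryZ n a x : cobdry n x -> cobdry n (a *: x).
Proof.
move=> [w [w1 w2 w3]]; exists (a *: w).
rewrite lim1_diffZ -scalerBr; split; [exact: tower_filZ|exact: tower_filZ|].
exact: subProdZ.
Qed.

Lemma cobdryN n x : cobdry n x -> cobdry n (- x).
Proof. by rewrite -scaleN1r; exact: cobdryZ. Qed.

Lemma cobdryB n x y : cobdry n x -> cobdry n y -> cobdry n (x - y).
Proof. by move=> hx hy; apply: cobdryD => //; exact: cobdryN. Qed.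

Lemma cobdry_diff n w : fil_P n w -> cobdry n (D w).
Proof.
move=> hw; exists w; rewrite subrr.
by split; [exact: hw|exact: (@fil0 _ fil_P)|exact: subProd0].
Qed.

Lemma cobdry_subProd n x : fil_P n x -> subProd C x -> cobdry n x.
Proof.
by move=> h1 h2; exists 0; rewrite lim1_diff0 subr0; split=> //; exact: fil0.
Qed.

Lemma cobdry0 n : cobdry n 0.
Proof. by apply: cobdry_subProd; [exact: fil0|exact: subProd0]. Qed.

Lemma cobdry_le m n y : (m <= n)%N -> cobdry n y -> cobdry m y.
Proof.
move=> mn [w [w1 w2 w3]]; exists w.
by split=> //; exact: (@fil_le _ fil_P _ n).
Qed.

(** One level is lost because coordinate [i] of [D w] involves coordinate [i.+1] of [w]. *)
Lemma cobdryS_fil n y : cobdry n.+1 y -> fil_P n y.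
Proof.
move=> [w [w1 w2 _]]; rewrite -[y](subrK (D w)).
apply: tower_filD; first exact: filS.
exact: lim1_diff_fil.
Qed.

Definition cobdrySubmodule : submodule P :=
  Submodule (cobdry0 0) (fun a x y hx => cobdryD (cobdryZ a hx)).

Local Notation B := (submodule_type cobdrySubmodule).

Lemma cobdry_valP (y : B) : cobdry 0 (val y).
Proof. by case: y => y /= /asboolP. Qed.

Definition to_cobdry y (hy : cobdry 0 y) : B :=
  @SubmoduleType R P cobdrySubmodule y (introT (asboolP _) hy).

Definition cobdry_fil n (y : B) : Prop := cobdry n (val y).

Lemma cobdry_filB n x y : cobdry_fil n x -> cobdry_fil n y -> cobdry_fil n (x - y).
Proof. by rewrite /cobdry_fil raddfB; exact: cobdryB. Qed.

Lemma cobdry_filS n x : cobdry_fil n.+1 x -> cobdry_fil n x.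
Proof. exact: cobdry_le. Qed.

Lemma cobdry_filZ n (a : R) x : cobdry_fil n x -> cobdry_fil n (a *: x).
Proof. by rewrite /cobdry_fil linearZ; exact: cobdryZ. Qed.

Lemma cobdry_fil_sep x : (forall n, cobdry_fil n x) -> x = 0.
Proof.
move=> h; apply: val_inj; rewrite linear0; apply: (@fil_sep _ fil_P) => n.
by apply: cobdryS_fil; exact: h.
Qed.

Lemma cobdry_fil_complete (u : nat -> B) :
  (forall n, cobdry_fil n (u n.+1 - u n)) ->
  exists l, forall n, cobdry_fil n (l - u n).
Proof.
move=> h; have [w0 [_ _ uw]] := cobdry_valP (u 0%N).
have /choice[v hv] n : exists w : P, [/\ fil_P n w,
    fil_P n (val (u n.+1) - val (u n) - D w) &
    subProd C (val (u n.+1) - val (u n) - D w)].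
  by have := h n; rewrite /cobdry_fil raddfB.
(* The increments are decomposed one at a time and their parts summed separately:
   [val (u n) = D (s n) + t n], with [s] and [t] both Cauchy in the product. *)
pose s n : P := w0 + \sum_(i < n) v i.
have sS n : s n.+1 = s n + v n by rewrite /s big_ord_recr /= addrA.
pose t n : P := val (u n) - D (s n).
have tS n : t n.+1 - t n = val (u n.+1) - val (u n) - D (v n).
  by rewrite /t sS lim1_diffD subrDBB.
have [n|ls hs] := @fil_complete _ fil_P s.
  by rewrite sS addrC addKr; have [] := hv n.
have [n|lt ht] := @fil_complete _ fil_P t.
  by rewrite tS; have [] := hv n.
have tC n : subProd C (t n).
  elim: n => [|n IH]; first by rewrite /t /s big_ord0 addr0.
  by rewrite -[t _](subrK (t n)) tS; apply: subProdD => //; have [] := hv n.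
have ltC : subProd C lt.
  (* Each coordinate of [t] becomes stationary, so the limit stays in the product of the [C n]. *)
  move=> n; suff -> : lt n = t n.+1 n by exact: tC.
  by apply/eqP; rewrite -subr_eq0; apply/eqP; exact: (ht n.+1 n (ltnSn n)).
have lC : cobdry 0 (D ls + lt).
  by apply: cobdryD; [exact: cobdry_diff|exact: cobdry_subProd].
exists (to_cobdry lC) => n; rewrite /cobdry_fil raddfB /=.
have -> : D ls + lt - val (u n) = D (ls - s n) + (lt - t n).
  by rewrite /t lim1_diffB; exact: addrBDB.
apply: cobdryD; first by apply: cobdry_diff; exact: hs.
by apply: cobdry_subProd; [exact: ht|exact: subProdB].
Qed.

Lemma cobdry_fil_count n : exists E : set B,
  countable E /\ forall x, exists2 d, E d & cobdry_fil n (x - d).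
Proof.
have [E [cE hE]] := fil_count fil_P n.
(* A cell of E(C) is given by approximations [p.1] of [w] and [p.2] of [y - D w]. Two elements of a
   cell differ by an element of V_n(C), and [f] picks one from every nonempty cell. *)
pose Q (p : P * P) (y : B) := exists w, [/\ fil_P n (w - p.1),
  subProd C (val y - D w) & fil_P n (val y - D w - p.2)].
have /choice[f hf] (p : P * P) : exists y : B, (exists z, Q p z) -> Q p y.
  have [[z Qz]|h] := pselect (exists z, Q p z); first by exists z.
  by exists 0 => /h.
exists (f @` (E `*` E)); split.
  by apply: (sub_countable (card_image_le _ _)); exact: countableX.
move=> x; have [w [_ _ xw]] := cobdry_valP x.
have [e1 De1 h1] := hE w; have [e2 De2 h2] := hE (val x - D w).
exists (f (e1, e2)); first by exists (e1, e2).
have [|v [v1 v2 v3]] := hf (e1, e2); first by exists x; exists w.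
rewrite /cobdry_fil raddfB /=; exists (w - v).
have -> : val x - val (f (e1, e2)) - D (w - v) =
  (val x - D w) - (val (f (e1, e2)) - D v).
  by rewrite lim1_diffB; exact: subrBB.
split; [|by apply: fil_trans h2 _; exact: filC|exact: subProdB].
by apply: fil_trans h1 _; exact: filC.
Qed.

Definition cobdry_filtration : filtration B :=
  Filtration cobdry_filB cobdry_filS cobdry_fil_sep cobdry_fil_count
    cobdry_fil_complete.

Definition cobdry_polish : polishModule K R :=
  filtration_polishModule K (V := cobdry_filtration) cobdry_filZ.

End Fixed.
End SubProduct.


(** * Inclusions between the E(C), and E(C)/N as a module with a Polish cover *)

Section Inclusions.
Context (K : realType) (R : pzRingType) (A : tower R).

Local Notation P := (tower_polish A K).
Local Notation D := (@lim1_diff K R A).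
Local Notation fil_P := (tower_prod_filtration A : filtration P).
Implicit Types C : forall n, submodule (A n).

Definition zeroSub n : submodule (A n).
Proof.
exists (fun x => x = 0) => // a x y -> ->.
by rewrite scaler0 addr0.
Defined.

Lemma cobdry_sub C C' : (forall n, C n `<=` C' n) ->
  forall n (y : P), cobdry C n y -> cobdry C' n y.
Proof.
by move=> CC' n y [w [w1 w2 w3]]; exists w; split=> // i; exact: CC'.
Qed.

Lemma subProd_zero (x : P) : subProd zeroSub x -> x = 0.
Proof. by move=> h; apply: functional_extensionality_dep => n; exact: h. Qed.

Lemma cobdry_zeroP n (y : P) :
  cobdry zeroSub n y <-> exists2 w : P, fil_P n w & y = D w.
Proof.
split=> [[w [w1 _ /subProd_zero/eqP]]|[w hw ->]]; last exact: cobdry_diff.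
by rewrite subr_eq0 => /eqP yw; exists w.
Qed.

Lemma cobdry_zero0 (y : P) : cobdry zeroSub 0 y <-> ker (lim1 K A) y.
Proof.
rewrite cobdry_zeroP; split=> [[w _ ->]|[w _ <-]]; first by exists w.
by exists w.
Qed.

Definition cobdry_val C (x : cobdry_polish K C) : P :=
  val (x : submodule_type (cobdrySubmodule K C)).

Lemma cobdry_val_linear C : linear (@cobdry_val C).
Proof. by move=> a x y; exact: (linearP val). Qed.

HB.instance Definition _ C := GRing.isLinear.Build R (cobdry_polish K C) P _
  (@cobdry_val C) (@cobdry_val_linear C).

Lemma cobdry_val_continuous C : continuous (@cobdry_val C).
Proof.
move=> x U /tower_prod_nbhsP[n nU]; exists n.+1 => y /= h; apply: nU => /=.
by move: h; rewrite /cobdry_fil raddfB /=; exact: cobdryS_fil.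
Qed.

Lemma cobdry_val_inj C : injective (@cobdry_val C).
Proof. exact: val_inj. Qed.

Lemma range_cobdry_val C : range (@cobdry_val C) = cobdry C 0.
Proof.
apply/seteqP; split=> [_ [x _ <-]|y hy]; first exact: cobdry_valP.
by exists (to_cobdry hy).
Qed.

Definition cobdry_incl C C' (CC' : forall n, C n `<=` C' n)
    (x : cobdry_polish K C) : cobdry_polish K C' :=
  to_cobdry (cobdry_sub CC' (cobdry_valP x)).

(** The inclusion of E(C) into E(C') sends V_n(C) into V_n(C'), hence is continuous. *)
Lemma cobdry_polishable C C' : (forall n, C n `<=` C' n) ->
  @polishable K R (cobdry_polish K C') [set y | cobdry C 0 (cobdry_val y)].
Proof.
move=> CC'; pose f := cobdry_incl CC'.
have fl : linear f.
  move=> a x y; apply: (@cobdry_val_inj C').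
  exact: etrans (cobdry_val_linear a x y)
    (esym (cobdry_val_linear a (f x) (f y))).
pose fL : {linear cobdry_polish K C -> cobdry_polish K C'} :=
  HB.pack f (GRing.isLinear.Build R _ _ _ f fl).
exists (cobdry_polish K C), fL; split.
- move=> x U [n nU]; exists n => y /= h; apply: nU => /=.
  have := cobdry_sub CC' h.
  by rewrite /cobdry_fil !raddfB /=.
- move=> x y /= /(congr1 (@cobdry_val C')) h; exact: val_inj.
- apply/seteqP; split=> [_ [x _ <-]|y hy]; first exact: cobdry_valP.
  by exists (to_cobdry hy) => //; exact: val_inj.
Qed.

Lemma cobdry_ker_polishable C :
  polishable [set y : cobdry_polish K C | ker (lim1 K A) (cobdry_val y)].
Proof.
have -> : [set y : cobdry_polish K C | ker (lim1 K A) (cobdry_val y)] =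
    [set y | cobdry zeroSub 0 (cobdry_val y)].
  by apply/seteqP; split=> y /cobdry_zero0.
by apply: cobdry_polishable => n _ ->; exact: submodule0.
Qed.

(** This is E(C)/N with E(C) in its own Polish topology rather than the one induced from the
    product, as the successor clause of [solecki] asks for [G']. *)
Definition cobdry_cover C : polishCover K R :=
  PolishCover (@cobdry_ker_polishable C).

End Inclusions.


(** * Sequences of finite support are coboundaries *)

Section FiniteSupport.
Context (K : realType) (R : pzRingType) (A : tower R).

Local Notation P := (tower_polish A K).
Local Notation D := (@lim1_diff K R A).
Local Notation fil_P := (tower_prod_filtration A : filtration P).

Definition delta n (b : A n) : P := dfwith (0 : P) n b.

Lemma deltaE n (b : A n) : delta b n = b.
Proof. exact: dfwithin. Qed.

Lemma delta_out n (b : A n) i : i != n -> delta b i = (0 : A i).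
Proof. by move=> ni; rewrite /delta dfwithout // eq_sym. Qed.

Lemma delta_fil n (b : A n) m : (m <= n)%N -> fil_P m (delta b).
Proof.
by move=> mn i im; apply: delta_out; rewrite ltn_eqF// (leq_trans im).
Qed.

Lemma lim1_diff_delta0 (b : A 0) : D (delta b) = delta b.
Proof.
apply: functional_extensionality_dep => i.
by rewrite lim1_diffE [delta b i.+1]delta_out// linear0 subr0.
Qed.

Lemma lim1_diff_deltaS n (b : A n.+1) :
  D (delta b) = delta b - delta (bond A n b).
Proof.
apply: functional_extensionality_dep => i.
rewrite lim1_diffE tower_subE; congr (_ - _).
have [->|ni] := eqVneq i n; first by rewrite !deltaE.
by rewrite !delta_out// linear0.
Qed.

(** Modulo coboundaries an entry moves down along the bonding map, and an entry at level 0 is its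
    own coboundary. *)
Lemma delta_cobdry n (b : A n) : range D (delta b).
Proof.
elim: n b => [b|n IH b]; first by exists (delta b) => //; exact: lim1_diff_delta0.
have [w _ hw] := IH (bond A n b); exists (w + delta b) => //.
by rewrite lim1_diffD hw lim1_diff_deltaS addrC subrK.
Qed.

(** An entry is lifted from level [i] to level [k + i] by telescoping; the correcting [w] is
    supported above level [i]. *)
Lemma delta_bonds i k (b : A (k + i)) :
  exists2 w : P, fil_P i w & delta (bonds b) - D w = delta b.
Proof.
elim: k b => [b|k IH b].
  by exists 0; [exact: (@fil0 _ fil_P)|rewrite lim1_diff0 subr0].
have [w wi hw] := IH (bond A (k + i) b).
exists (w - delta b).
  by apply: (@filB _ fil_P) => //; apply: delta_fil; rewrite leq_addl.
have -> : D (w - delta b) = D w + delta (bond A _ b) - delta b.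
  by rewrite lim1_diffB (lim1_diff_deltaS (b : A (k + i).+1)) opprB addrA.
by rewrite /= -addrA opprD addrA hw opprB addrC subrK.
Qed.

Definition trunc m (x : P) : P := fun i => if (i < m)%N then x i : A i else 0.

Lemma truncS m (x : P) : trunc m.+1 x = trunc m x + delta (x m : A m).
Proof.
apply: functional_extensionality_dep => i; rewrite tower_addE /trunc ltnS.
have [->|ni] := eqVneq i m; first by rewrite leqnn ltnn deltaE add0r.
by rewrite delta_out// addr0 ltn_neqAle ni.
Qed.

Lemma trunc0 (x : P) : trunc 0 x = 0.
Proof. exact: functional_extensionality_dep. Qed.

Lemma trunc_fil m (x : P) : fil_P m (x - trunc m x).
Proof. by move=> i im; rewrite tower_subE /trunc im subrr. Qed.

Lemma trunc_cobdry m (x : P) : range D (trunc m x).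
Proof.
elim: m => [|m [w _ hw]]; first by
  rewrite trunc0; exists 0 => //; rewrite lim1_diff0.
have [v _ hv] := delta_cobdry (x m : A m).
by exists (w + v) => //; rewrite lim1_diffD truncS hw hv.
Qed.

Lemma subProd_trunc (C : forall n, submodule (A n)) m (x : P) :
  subProd C x -> subProd C (trunc m x).
Proof. by move=> hx i; rewrite /trunc; case: ifP => // _; exact: submodule0. Qed.

(** N is dense in E(C): subtracting from [y - D w] its truncation, a coboundary, leaves a remainder
    in V_n(C). *)
Lemma cobdry_near (C : forall n, submodule (A n)) n (y : P) : cobdry C 0 y ->
  exists w : P, fil_P n (y - D w) /\ subProd C (y - D w).
Proof.
move=> [w [_ _ wB]]; have [v _ vE] := trunc_cobdry n (y - D w).
exists (w + v); rewrite lim1_diffD vE opprD addrA.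
by split; [exact: trunc_fil|apply: subProdB => //; exact: subProd_trunc].
Qed.

Lemma bonds_eq k i (u : P) : (forall j, (j < k + i)%N -> D u j = 0 :> A j) ->
  u i = bonds (u (k + i)%N : A (k + i)).
Proof.
elim: k => [//|k IH] h; rewrite IH; last by move=> j jk; apply: h; exact: ltnW.
by congr bonds; have /eqP := h (k + i)%N (ltnSn _); rewrite subr_eq0 => /eqP.
Qed.

End FiniteSupport.

(** * The successor step s_1(E(B)/N) = E(B1)/N *)

Section Solecki1.
Context (K : realType) (R : pzRingType) (A : tower R).

Local Notation P := (tower_polish A K).
Local Notation D := (@lim1_diff K R A).
Local Notation fil_P := (tower_prod_filtration A : filtration P).

Local Notation delta := (@delta K R A _).

Variables B B1 : forall n, submodule (A n).
Hypothesis B1P : forall n (x : A n),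
  B1 n x <-> forall k : nat, exists2 y : A (k + n)%N, B _ y & bonds y = x.
(** This expresses that the inverse limit of A / B vanishes. *)
Hypothesis B_lim : forall u : P, subProd B (D u) -> subProd B u.

Hypothesis B1_bond : forall n (x : A n.+1), B1 _ x -> B1 _ (bond A n x).

Lemma B1_subset n : B1 n `<=` B n.
Proof. by move=> x /B1P/(_ 0%N)[y By <-]. Qed.

(* The inclusion of V_n(B1) in the closure of V_n(0). *)
Lemma subProd_approx n m (x : P) : fil_P n x -> subProd B1 x ->
  exists w : P, [/\ fil_P n w, fil_P m (x - D w) & subProd B (x - D w)].
Proof.
move=> nx xB1.
have [w [wn wm wB]] : exists w : P, [/\ fil_P n w, fil_P m (trunc m x - D w) &
    subProd B (trunc m x - D w)].
  suff H i : exists w : P, [/\ fil_P n w, fil_P m (trunc i x - D w) &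
    subProd B (trunc i x - D w)] by exact: H.
  elim: i => [|i [w [w1 w2 w3]]].
    exists 0; rewrite trunc0 lim1_diff0 subr0.
    by split; [exact: (@fil0 _ fil_P)|exact: (@fil0 _ fil_P)|exact: subProd0].
  (* The entry [x i] comes from some [b] in B at level [m + i]; trading one for the other by a
     coboundary leaves nothing below level [m]. If [i < n], the entry is zero already and [v = 0]
     keeps [v] in the filtration. *)
  have [b Bb xb] := (B1P _).1 (xB1 i) m.
  have [v [vn vE]] : exists v : P, fil_P n v /\
      (delta (x i : A i) - D v = delta b \/ delta (x i : A i) - D v = 0).
    have [ni|lt_in] := leqP n i.
      have [v vi vE] := delta_bonds K b; exists v; split; first exact: fil_le vi.
      by left; rewrite -xb.
    exists 0; split; first exact: (@fil0 _ fil_P).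
    right; rewrite lim1_diff0 subr0.
    apply: functional_extensionality_dep => j.
    have [->|ji] := eqVneq j i; first by rewrite deltaE; exact: nx.
    exact: delta_out.
  exists (w + v); have -> : trunc i.+1 x - D (w + v) =
      trunc i x - D w + (delta (x i : A i) - D v).
    by rewrite truncS lim1_diffD opprD addrACA.
  split; first exact: tower_filD.
    apply: tower_filD => //; case: vE => ->; last exact: (@fil0 _ fil_P).
    by apply: delta_fil; rewrite leq_addr.
  apply: subProdD => //; case: vE => ->; last exact: subProd0.
  move=> j; have [->|jm] := eqVneq j (m + i)%N; first by rewrite deltaE.
  by rewrite delta_out//; exact: submodule0.
exists w; have -> : x - D w = (x - trunc m x) + (trunc m x - D w).
  by rewrite addrA subrK.
split=> //; first by apply: tower_filD => //; exact: trunc_fil.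
apply: subProdD => //; have xB : subProd B x by move=> i; exact: B1_subset.
by apply: subProdB => //; exact: subProd_trunc.
Qed.

Local Notation G := (cobdry_cover K B).
Local Notation V := (cobdry_filtration K B).
Local Notation cval := (@cobdry_val K R A B).

(** The approximation in the form used for both halves: within E(B), a closed set containing [a] +
    V_n(0) contains [a] + V_n(B1). *)
Lemma cobdry_B1_closure n (a s : P) (C : set G) (Cc : closed C) (x : G) :
  cval x = a + s -> cobdry B1 n s ->
  (forall (w : P) (z : G), fil_P n w -> cval z = a + D w -> C z) -> C x.
Proof.
move=> xas [v [vn sn sB1]] aC; apply: Cc => U [m mU].
have [w [wn wm wB]] := subProd_approx m sn sB1.
have hz : cobdry B 0 (cval x - (s - D v - D w)).
  apply: (cobdryB (cobdry_valP _)); apply: cobdry_subProd => //.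
exists (to_cobdry hz); split; last first.
  apply: mU; apply: (@filC _ V); rewrite /= /cobdry_fil raddfB /=.
  rewrite opprB addrC subrK.
  exact: cobdry_subProd.
apply: (aC (v + w)); first exact: tower_filD.
rewrite /cobdry_val /= -/(cval x) xas lim1_diffD.
by rewrite -[s - _ - _]addrA -opprD opprB -addrA [s + _]addrC subrK.
Qed.


Lemma cobdry_B1_Pi03 : Pi03 [set y : G | cobdry B1 0 (cval y)].
Proof.
have /choice[E hE] := fil_count fil_P.
have /choice[f hf] n : exists f : P -> nat, {in E n &, injective f}.
  by have [/countable_injP] := hE n.
(* [T n j] is D d + V_n(0) for the [d] in [E n] that [f n] numbers [j], and is empty if there is
   none. *)
pose T n j : set G := [set z | exists d w : P,
  [/\ E n d, f n d = j, fil_P n (w - d) & cval z = D w]].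
exists (fun n => \bigcup_j closure (T n j)).
  by move=> n; exists (fun j => closure (T n j)) => // j; exact: closed_closure.
apply/seteqP; split=> [y yB1 n _|y yT].
  have [w [wn wB1]] := cobdry_near n yB1.
  have [_ /(_ w)[d Ed wd]] := hE n; exists (f n d) => //.
  apply: (@cobdry_B1_closure n (D w) (cval y - D w)) => //.
  - exact: closed_closure.
  - by rewrite addrC subrK.
  - exact: cobdry_subProd.
  - move=> v z vn zE; apply: subset_closure; exists d, (w + v).
    by rewrite lim1_diffD addrAC; split=> //; exact: tower_filD.
(* [u n] is the centre [d] of a closure containing [y] at stage [n]. The approximating [w] depends
   on [m], but always agrees with [u n] below level [n]. *)
have /choice[u hu] n : exists d : P, forall m, exists w : P,
    [/\ fil_P n (w - d), fil_P m (cval y - D w) & subProd B (cval y - D w)].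
  have [j _ yj] := yT n I.
  have near m : exists2 z, T n j z & V m (z - y).
    by have [|z [Tz zy]] := yj [set z | V m (z - y)]; [exists m|exists z].
  have [_ [d [_ [Ed fd _ _]]] _] := near 0%N.
  (* The precision [maxn m n] makes the correction [v] vanish below level [n] too, so that [w + v]
     still agrees with [d] there. *)
  exists d => m; have [z [d' [w [Ed' fd' wd' zE]]] zy] := near (maxn m n).
  have dd' : d' = d by apply: (hf n); rewrite ?inE// fd.
  rewrite dd' in wd'.
  have [v [v1 v2 v3]] : cobdry B (maxn m n) (cval y - D w).
    by rewrite -zE; have /filC := zy; rewrite /= /cobdry_fil raddfB.
  exists (w + v); rewrite lim1_diffD opprD addrA; split=> //.
    rewrite addrAC; apply: tower_filD => //; apply: fil_le v1; exact: leq_maxr.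
  by apply: fil_le v2; exact: leq_maxl.
(* Approximations [w] and [v] from two successive stages have [D (v - w)] in the product of the
   [B n] and zero below level [k + i]. The former puts [v - w] in B by [B_lim]; the latter makes its
   coordinate [i] the image of its coordinate [k + i]. *)
have uB1 n i : (i < n)%N -> B1 i ((u n.+1 - u n) i).
  move=> lt_in; apply/B1P => k.
  have [w [w1 w2 w3]] := hu n (k + i)%N.
  have [v [v1 v2 v3]] := hu n.+1 (k + i)%N.
  have DE : D (v - w) = (cval y - D w) - (cval y - D v).
    by rewrite lim1_diffB; exact: subr_subl.
  have vwB : subProd B (v - w) by apply: B_lim; rewrite DE; exact: subProdB.
  exists ((v - w) (k + i)%N); first exact: vwB.
  rewrite -bonds_eq.
    have /eqP := w1 i lt_in; rewrite tower_subE subr_eq0 => /eqP wi.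
    have /eqP := v1 i (ltnW lt_in); rewrite tower_subE subr_eq0 => /eqP vi.
    by rewrite !tower_subE wi vi.
  by rewrite DE; exact: (@filB _ fil_P).
(* [D] at [i] involves coordinates [i] and [i.+1], and [u i.+2] is correct at both. The error at [i]
   is then the image of [u i.+3 - u i.+2] at [i.+1], which [uB1] controls. *)
pose w : P := fun i => u i.+2 i.
exists w; split; [by []|by []|] => i.
have [v [v1 v2 _]] := hu i.+2 i.+1.
have /eqP := v1 i (ltnW (ltnSn _)); rewrite tower_subE subr_eq0 => /eqP vi.
have /eqP := v1 i.+1 (ltnSn _); rewrite tower_subE subr_eq0 => /eqP vi1.
have /eqP := v2 i (ltnSn _).
rewrite tower_subE subr_eq0 lim1_diffE vi vi1 => /eqP yi.
have -> : (cval y - D w) i = bond A i ((u i.+3 - u i.+2) i.+1).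
  rewrite tower_subE yi lim1_diffE tower_subE (raddfB (bond A i)) /=.
  exact: esym (subr_subl _ _ _).
by apply: B1_bond; exact: uB1.
Qed.

Lemma zeroSub_B n : zeroSub A n `<=` B n.
Proof. by move=> _ ->; exact: submodule0. Qed.

Lemma zeroSub_B1 n : zeroSub A n `<=` B1 n.
Proof. by move=> _ ->; exact: submodule0. Qed.

Lemma cobdry_B1_minimal (S : set G) : Pi03_submodule S ->
  [set y : G | cobdry B1 0 (cval y)] `<=` S.
Proof.
move=> [kS [M [f [_ _ fS]]] [F Fsig SF]].
have SB x y : S x -> S y -> S (x - y).
  rewrite -fS => -[x' _ <-] [y' _ <-].
  by exists (x' - y') => //; exact: raddfB.
have /choice[C hC] i : exists C : nat -> set G,
    (forall j, closed (C j)) /\ F i = \bigcup_j C j.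
  by have [C Cc FC] := Fsig i; exists C.
pose inc := cobdry_incl (K := K) B1_subset.
pose inc0 := cobdry_incl (K := K) zeroSub_B.
pose V1 := cobdry_filtration K B1.
pose V0 := cobdry_filtration K (zeroSub A).
suff H : forall s, S (inc s).
  move=> y hy; have -> : y = inc (to_cobdry hy) by exact: val_inj.
  exact: H.
apply: (@filtration_comeager_subgroup _ V1 _ (fun i => [set s | F i (inc s)])).
- move=> x y Sx Sy; have -> : inc (x - y) = inc x - inc y by exact: val_inj.
  exact: SB.
- move=> i b n.
  (* Density of N in E(B1) moves the centre of the given coset to the point [D w] of N. *)
  have [w [wn wB1]] := cobdry_near n (cobdry_valP b).
  have hw : cobdry (zeroSub A) 0 (D w) by exact: cobdry_diff.
  (* N lies in [S], hence is covered by the closed sets [C i j]; Baire category in the Polish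
     topology of N puts a coset of V_m(0) into one of them. *)
  have [||j [a [m [aw am]]]] := @filtration_baire_cover _ V0
      (fun j => [set z | C i j (inc0 z)]) _ (to_cobdry hw) n.
  + move=> j x xj; apply: (hC i).1 => U [m mU].
    have [y yx Cy] := xj m; exists (inc0 y); split=> //; apply: mU => /=.
    by move: yx; rewrite /= /cobdry_fil !raddfB /=; exact: (cobdry_sub zeroSub_B).
  + move=> x _; have : S (inc0 x).
      by apply: kS => /=; apply/cobdry_zero0; exact: cobdry_valP.
    by rewrite SF => /(_ i I); rewrite (hC i).2 => -[j _ Cx]; exists j.
  pose a1 := cobdry_incl (K := K) zeroSub_B1 a.
  exists a1, m; split.
    apply: (@fil_trans _ V1 _ _ (cobdry_incl (K := K) zeroSub_B1 (to_cobdry hw))).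
      by move: aw; rewrite /= /cobdry_fil !raddfB /=; exact: (cobdry_sub zeroSub_B1).
    apply: filC; rewrite /= /cobdry_fil raddfB /=; exact: cobdry_subProd.
  move=> y ya /=; rewrite (hC i).2; exists j => //.
  (* Being closed, [C i j] also contains the coset of V_m(B1) with the same centre. *)
  apply: (@cobdry_B1_closure m (val a) (val y - val a)).
  + exact: (hC i).1.
  + by rewrite addrC subrK.
  + by move: ya; rewrite /= /cobdry_fil raddfB.
  + move=> w' z w'm zE.
    have hz : cobdry (zeroSub A) 0 (cval z).
      by rewrite zE; apply: cobdryD; [exact: cobdry_valP|exact: cobdry_diff].
    have -> : z = inc0 (to_cobdry hz) by exact: val_inj.
    apply: am => /=; rewrite /cobdry_fil raddfB /= zE addrC addKr.
    exact: cobdry_diff.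
- by move=> s Fs; rewrite SF => i _; exact: Fs.
Qed.

Lemma cobdry_solecki1 : is_solecki1 [set y : G | cobdry B1 0 (cval y)].
Proof.
split; last exact: cobdry_B1_minimal; split.
- move=> y /cobdry_zero0; exact: (cobdry_sub zeroSub_B1).
- exact: cobdry_polishable B1_subset.
- exact: cobdry_B1_Pi03.
Qed.

End Solecki1.


(** * The derived towers and the transfinite induction *)

Section DerivedTower.
Context (K : realType) {d : Order.disp_t} (W : orderType d)
  (e : fundamentalSystem W).
Hypothesis hW : is_omega1 W.
Context (R : pzRingType) (A : tower R).

Local Notation P := (tower_polish A K).
Local Notation D := (@lim1_diff K R A).
Local Notation fil_P := (tower_prod_filtration A : filtration P).
Local Notation C a := (derived_sub e A hW a).

Lemma fund_limit_lt l n : is_limit l -> (e l n < l)%O.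
Proof. by move=> ll; apply: lt_le_trans (fund_incr e n ll) (fund_le e l _). Qed.

Lemma fund_le_mono a m n : (m <= n)%N -> (e a m <= e a n)%O.
Proof.
elim: n => [|n IH]; first by rewrite leqn0 => /eqP->.
rewrite leq_eqVlt => /predU1P[->//|/IH h]; exact: le_trans h (fund_leS e a n).
Qed.

(* The inverse limit of A / A_a vanishes; n0 makes the induction go through at
   limits, where only the levels n >= n0 lie in A_(a_n0). *)
Lemma derived_lim a (u : forall n, A n) n0 :
  (forall n, (n0 <= n)%N -> derived e (e a n) (u n - bond A n (u n.+1))) ->
  forall n, (n0 <= n)%N -> derived e (e a n) (u n).
Proof.
elim/(well_founded_ind (omega1_wf hW)): a n0 => a IH n0 hu n nn0.
have [la|na] := pselect (is_limit a).
  (* At a limit the claim at level [n] concerns only the successor [e a n], for which the hypothesis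
     holds from level [n] on because the sequence increases. *)
  have ea m : e (e a n) m = e a n by rewrite fund_const//; exact: fund_nonlimit.
  rewrite -(ea n); apply: (IH _ (fund_limit_lt n la) n) => // m nm.
  rewrite ea; apply: derived_le (hu m (leq_trans nn0 nm)) => //.
    exact: fund_nonlimit.
  exact: fund_le_mono.
have ea m : e a m = a by rewrite fund_const.
case: (nonlimitP na) => [za|[b ba]]; first by rewrite ea; exact: derived_zero.
have {}hu m : (n0 <= m)%N -> derived e a (u m - bond A m (u m.+1)).
  by move=> /hu; rewrite ea.
have ub m : (n0 <= m)%N -> derived e (e b m) (u m).
  apply: (IH b ba.1) => {}m mn0; apply: derived_le (hu m mn0) => //.
    exact: fund_nonlimit.
  exact: ltW (fund_pred_lt e m ba).
rewrite ea; apply/(derived_succP _ _ ba) => k.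
(* By telescoping, [u n] differs from the image of [u (k + n)] by an element of A_a, that is, by the
   image of a point of A_(b_k) at level [k + n]. By [ub] and monotonicity [u (k + n)] lies in
   A_(b_k) as well. *)
have dk : derived e a (u n - bonds (u (k + n)%N : A (k + n))).
  have [da0 daP] := derived_submodule e A hW na n.
  have daD (x y : A n) : derived e a x -> derived e a y -> derived e a (x + y).
    by move=> dx dy; rewrite -[x]scale1r; exact: daP.
  elim: k => [|k IHk]; first by rewrite subrr.
  have -> : u n - bonds (u (k.+1 + n)%N : A (k.+1 + n)) =
    u n - bonds (u (k + n)%N : A (k + n)) +
    bonds (u (k + n)%N - bond A (k + n) (u (k + n).+1)).
    by rewrite raddfB addrA subrK.
  apply: daD => //; apply: derived_bonds => //; apply: hu.
  by rewrite (leq_trans nn0)// leq_addl.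
have [y dy yE] := (derived_succP e _ ba).1 dk k.
exists (y + u (k + n)%N); last by rewrite raddfD /= yE subrK.
have nb := @fund_nonlimit _ _ e b k.
have [_ dP] := derived_submodule e A hW nb (k + n).
rewrite -[y]scale1r; apply: dP => //.
apply: derived_le (ub (k + n)%N _) => //; last first.
  by rewrite (leq_trans nn0)// leq_addl.
by apply: fund_le_mono; rewrite leq_addr.
Qed.

Lemma subProd_derived_lim a (u : P) : subProd (C a) (D u) -> subProd (C a) u.
Proof. by move=> hu n; exact: (derived_lim (fun m (_ : (0 <= m)%N) => hu m)). Qed.

(** The definition of A_a takes A_(b_k) at level [k + n], whereas the tower A_b has A_(b_(k+n))
    there. The intersections agree: lift further, then project back. *)
Lemma derived_sub_succP a b n (x : A n) : is_succ_of b a ->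
  C a n x <-> forall k : nat, exists2 y : A (k + n)%N, C b _ y & bonds y = x.
Proof.
move=> ba; have na : ~ is_limit a by move=> [_]; apply; exists b.
rewrite /= (fund_const e n na) (derived_succP e _ ba); split=> h k.
  have H j : (k <= j)%N -> forall c,
      (exists2 y : A (j + n)%N, derived e c y & bonds y = x) ->
      exists2 y : A (k + n)%N, derived e c y & bonds y = x.
    elim: j => [|j IH].
      by rewrite leqn0 => /eqP->.
    rewrite leq_eqVlt => /predU1P[->//|/IH {}IH] c [y dy yx].
    by apply: IH; exists (bond A (j + n) y) => //; exact: derived_bond.
  by apply: (H (k + n)%N _ (e b (k + n)%N)); [rewrite leq_addr|].
have [y dy yx] := h k; exists y => //.
apply: derived_le dy => //; first exact: fund_nonlimit.
by apply: fund_le_mono; rewrite leq_addr.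
Qed.

Lemma derived_sub_bond a n (x : A n.+1) : C a n.+1 x -> C a n (bond A n x).
Proof.
move=> /= dx; apply: derived_bond => //.
by apply: derived_le dx => //; [exact: fund_nonlimit|exact: fund_leS].
Qed.

Lemma derived_cobdry_limit l : is_limit l ->
  cobdry (C l) 0 = \bigcap_(b in [set b | (b < l)%O]) cobdry (K := K) (C b) 0.
Proof.
move=> ll; apply/seteqP; split=> [y yl b bl|y yb].
  have [m bm] : exists m, (b < e l m)%O.
    apply: contrapT => h; move: (bl); rewrite /= ltNge => /negP; apply.
    apply: (fund_sup e ll).2 => _ [m _ <-]; rewrite leNgt; apply/negP => bm.
    by apply: h; exists m.
  (* Coordinates below [m] are removed by a coboundary; from [m] on, A_(l_i) is contained in
     A_(b_i). *)
  have [w [wm wl]] := cobdry_near m yl; exists w; split=> // i.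
  have [im|mi] := ltnP i m; first by rewrite wm//; exact: submodule0.
  apply: derived_le (wl i) => //=; first exact: fund_nonlimit.
  apply: le_trans (fund_le e b i) _; apply: le_trans (ltW bm) _.
  exact: fund_le_mono.
have el n m : e (e l n) m = e l n by rewrite fund_const//; exact: fund_nonlimit.
have /choice[w hw] n : exists w : P, subProd (C (e l n)) (y - D w).
  by have [w [_ _ hw]] := yb _ (fund_limit_lt n ll); exists w.
(* The diagonal works because [w n - w n.+1] lies in A_(l_n): its coboundary does, and the inverse
   limit of A / A_(l_n) vanishes. *)
exists (fun n => w n n : A n); split=> // n.
have hS : subProd (C (e l n)) (w n - w n.+1).
  apply: subProd_derived_lim; rewrite lim1_diffB (subr_subl _ y).
  apply: subProdB => // i /=; rewrite el; have := hw n.+1 i; rewrite /= el.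
  by apply: derived_le => //; [exact: fund_nonlimit|exact: fund_leS].
have -> : (y - D (fun n => w n n : A n)) n =
    (y - D (w n)) n - bond A n ((w n - w n.+1) n.+1).
  rewrite !tower_subE !lim1_diffE (raddfB (bond A n)) /=.
  rewrite -addrA; congr (_ + _); rewrite -opprD; congr (- _).
  by rewrite addrA subrK.
apply: submoduleB; first by have := hw n n; rewrite /= el.
by apply: derived_bond => //; have := hS n.+1; rewrite /= el.
Qed.

Local Notation incl a := (lim1_map K (derived_incl e A hW a)).

Lemma incl_subProd a (z : lim1 K (derived_tower e A hW a)) :
  subProd (C a) (incl a z).
Proof. by move=> n; have := submodule_valP (z n) => /asboolP. Qed.

Lemma subProd_incl a (x : P) : subProd (C a) x -> exists z, incl a z = x :> P.
Proof.
move=> hx.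
exists (fun n =>
  SubmoduleType (introT (asboolP _) (hx n)) : derived_tower e A hW a n).
exact: functional_extensionality_dep.
Qed.

(** If [z] becomes a coboundary [D w] over A, the vanishing of the inverse limit of A / A_a forces
    [w] into the derived tower. *)
Lemma incl_cover_injective a : cover_injective (incl a).
Proof.
move=> z [w _ wz].
have [v vw] : exists v, incl a v = w :> P.
  by apply/subProd_incl/subProd_derived_lim; rewrite wz; exact: incl_subProd.
exists v => //; apply: functional_extensionality_dep => n; apply: val_inj.
rewrite -[RHS]/((incl a z : P) n) -wz -vw; exact: (raddfB val).
Qed.

Lemma incl_cover_image a : cover_image (incl a) = cobdry (C a) 0.
Proof.
apply/seteqP; split=> [y [z [w _ wE]]|y [w [_ _ /subProd_incl[z zE]]]].
  exists w; rewrite wE opprB addrC subrK; split=> //; exact: incl_subProd.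
exists z; rewrite zE opprB addrC subrK.
by exists w.
Qed.

Lemma derived_solecki a : solecki (G := lim1 K A) a (cobdry (C a) 0).
Proof.
elim/(well_founded_ind (omega1_wf hW)): a => a IH.
have [la|na] := pselect (is_limit a).
  rewrite derived_cobdry_limit//.
  apply: (solecki_limit (G := lim1 K A) (S := fun b => cobdry (C b) 0) la).
  by move=> b; exact: IH.
case: (nonlimitP na) => [za|[b ba]].
  suff -> : cobdry (C a) 0 = closure (ker (lim1 K A)) by exact: solecki_zero.
  (* Both sides are the whole product: A_0 is A, and the truncations of any [y] are coboundaries
     converging to it. *)
  apply/seteqP; split=> y _.
    move=> U /tower_prod_nbhsP[n nU]; exists (trunc n y); split.
      exact: trunc_cobdry.
    by apply: nU; apply: (@filC _ fil_P); exact: trunc_fil.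
  apply: cobdry_subProd => // n; apply: derived_zero.
  by rewrite fund_const.
(* E(A_b)/N is the [G'] of the successor clause, so E(A_a) is rewritten as the image of a subset of
   E(A_b). *)
have -> : cobdry (C a) 0 = @cobdry_val K R A (C b) @`
    [set y : cobdry_cover K (C b) | cobdry (C a) 0 (cobdry_val y)].
  apply/seteqP; split=> [y ya|_ [y ya <-] //].
  have yb : cobdry (C b) 0 y.
    apply: cobdry_sub ya => n x /(derived_sub_succP _ ba)/(_ 0%N)[z Cz <-].
    exact: Cz.
  by exists (to_cobdry yb).
apply: (@solecki_succ _ _ K R (lim1 K A) a b (cobdry (C b) 0)
  (cobdry_cover K (C b))) => //.
- exact: IH ba.1.
- exact: cobdry_val_continuous.
- exact: range_cobdry_val.
- apply: cobdry_solecki1.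
  + by move=> n x; exact: derived_sub_succP.
  + exact: subProd_derived_lim.
  + exact: derived_sub_bond.
Qed.

End DerivedTower.

Theorem theorem7p6 (K : realType) (d : Order.disp_t) (W : orderType d)
    (hW : is_omega1 W) (e : fundamentalSystem W)
    (R : idomainType) (R_countable : countable [set: R])
    (A : tower R) (alpha : W) :
  let i : coverHom (lim1 K (derived_tower e A hW alpha)) (lim1 K A) :=
    lim1_map K (derived_incl e A hW alpha) in
  cover_injective i /\ solecki alpha (cover_image i).
Proof.
move=> i; split; first exact: incl_cover_injective.
by rewrite incl_cover_image; exact: derived_solecki.
Qed.
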